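(* Let $K$ be a number field of degree $n$ with ring of integers $\mathcal{O}_K$, and let $M_\infty(K)$ denote the set of infinite places of $K$. Then any ideal class of order $2$ in the class group of $\mathcal{O}_K$ has a representative ideal $I\subset\mathcal{O}_K$ such that $I^2=\beta\mathcal{O}_K$ for some $\beta\in\mathcal{O}_K$ with $|\beta|_v\le|\mathrm{Disc}(K)|^{1/n}$ for all $v\in M_\infty(K)$.
   Context: $\mathrm{Disc}(K)$ is the absolute discriminant of $K$. For an infinite place $v$ corresponding to an embedding $\sigma:K\to\mathbb{C}$ (real, or one of a complex conjugate pair), $|x|_v=|\sigma(x)|$ is the usual (unsquared) absolute value. *)

(* Defs.v *)
From HB Require Import structures.
From mathcomp Require Export all_boot all_order all_algebra all_field.
From mathcomp Require Export all_classical all_reals all_analysis.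
From mathcomp Require Export complex.

Set Implicit Arguments.
Unset Strict Implicit.
Unset Printing Implicit Defensive.

Import Order.TTheory GRing.Theory Num.Theory.
Local Open Scope classical_set_scope.
Local Open Scope ring_scope.

(* A number field is a [K : fieldExtType rat]; its degree is [\dim {:K}].
   Ideals are subsets of K, so that fractional and integral ideals have the
   same type. *)

Definition ring_of_integers (K : fieldExtType rat) : set K :=
  [set x | integralOver (intr : int -> K) x].

(* Trace of the Q-linear map "multiplication by x". *)
Definition field_trace (K : fieldExtType rat) (x : K) : rat :=
  \tr (passmx.mxof (vbasis {:K}) (vbasis {:K}) (amull x)).

Definition integral_basis (K : fieldExtType rat)
    (w : (\dim {:K}).-tuple K) : Prop :=
  (forall i, ring_of_integers (tnth w i)) /\
  (forall x : K, ring_of_integers x ->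
     exists! c : {ffun 'I_(\dim {:K}) -> int}, x = \sum_i tnth w i *~ c i).

Definition basis_disc (K : fieldExtType rat) (w : (\dim {:K}).-tuple K) : rat :=
  \det (\matrix_(i, j) field_trace (tnth w i * tnth w j)).

(* The value does not depend on the integral basis; the default value 0 is only
   there to make the definition total, as every number field has an integral
   basis. *)
Definition field_disc (K : fieldExtType rat) : rat :=
  xget 0 [set basis_disc w | w in @integral_basis K].

(* Nonzero O_K-submodules of K with a common denominator. *)
Definition fractional_ideal (K : fieldExtType rat) (I : set K) : Prop :=
  [/\ I 0,
      forall x y, I x -> I y -> I (x + y),
      forall a x, ring_of_integers a -> I x -> I (a * x),
      exists2 x, I x & x != 0
    & exists d, [/\ ring_of_integers d, d != 0 &
        forall x, I x -> ring_of_integers (d * x)]].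

Definition ideal_scale (K : fieldExtType rat) (a : K) (I : set K) : set K :=
  [set a * x | x in I].

Definition principal_ideal (K : fieldExtType rat) (a : K) : set K :=
  ideal_scale a (@ring_of_integers K).

(* Finite sums of products x * y with x in I and y in J. *)
Definition ideal_mul (K : fieldExtType rat) (I J : set K) : set K :=
  [set z | exists2 s : seq (K * K),
     (forall p, p \in s -> I p.1 /\ J p.2) & z = \sum_(p <- s) p.1 * p.2].

Definition ideal_class (K : fieldExtType rat) (I : set K) : set (set K) :=
  [set J | exists2 a : K, a != 0 & J = ideal_scale a I].

Definition class_group (K : fieldExtType rat) : set (set (set K)) :=
  [set ideal_class I | I in @fractional_ideal K].

Definition class_one (K : fieldExtType rat) : set (set K) :=
  ideal_class (@ring_of_integers K).

(* On elements of the class group, [I] * [J] = [I J]. *)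
Definition class_mul (K : fieldExtType rat) (c d : set (set K)) : set (set K) :=
  [set L | exists I J, [/\ c I, d J & ideal_class (ideal_mul I J) L]].

Definition class_order2 (K : fieldExtType rat) (c : set (set K)) : Prop :=
  c <> @class_one K /\ class_mul c c = @class_one K.

(* An infinite place is identified with its absolute value x |-> |sigma x|, so
   that conjugate embeddings give the same place.  The norm on R[i] takes its
   values in R[i], whence the cast of [v x]. *)
Definition infinite_places (R : realType) (K : fieldExtType rat) :
    set (K -> R) :=
  [set v | exists sigma : {rmorphism K -> R[i]},
     forall x, (v x)%:C%C = `|sigma x|].

(* Main.v *)
(* Write J^2 = alpha O for an ideal J in the class. The lattice J, with the
   embedding sigma scaled by |sigma alpha|^(-1/2), has covolume at most
   |Disc|^(1/2), so Minkowski's theorem on linear forms gives a nonzero x in J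
   with |sigma x|^2 <= |sigma alpha| |Disc|^(1/n) for all sigma; then
   I = (x / alpha) J and beta = x^2 / alpha work.

   Minkowski's theorem follows for integer matrices from the pigeonhole
   principle modulo the lattice (its index is the determinant, by the Smith
   normal form), and for real ones by approximation. The covolume of J is
   bounded without prime factorization of ideals, in the spirit of Kronecker:
   over polynomials, J is generated by f = \sum_i j_i X^i for a basis (j_i), and
   f(X) f(X^n) / alpha has coefficients generating the unit ideal, so its norm
   is a primitive polynomial. *)

From HB Require Import structures.
Require Import Defs.
From mathcomp Require Import perm ring lra zify.

Set Implicit Arguments.
Unset Strict Implicit.
Unset Printing Implicit Defensive.

Import Order.TTheory GRing.Theory Num.Theory numFieldNormedType.Exports.
Local Open Scope classical_set_scope.
Local Open Scope ring_scope.

(** * Commuting pencils of matrices *)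

(* McCoy's argument: a polynomial vector of minimal degree annihilated by the
   pencil is annihilated by each of its coefficients, hence by 1. *)
Lemma det_commuting_pencil_neq0 (F : fieldType) (n : nat) (I : finType)
    (e : I -> nat) (U : I -> 'M[F]_n) (c : I -> F) :
  injective e -> (forall i j, U i *m U j = U j *m U i) ->
  \sum_i c i *: U i = 1%:M ->
  \det (\sum_i 'X^(e i) *: map_mx polyC (U i)) != 0.
Proof.
move=> inj_e commU sumU; set P := \sum_i _.
pose Up i : 'M[{poly F}]_n := map_mx polyC (U i).
have commUp i : P *m Up i = Up i *m P.
  rewrite mulmx_suml mulmx_sumr; apply: eq_bigr => j _.
  by rewrite -scalemxAl -scalemxAr -!map_mxM commU.
(* Induction on a bound [d] for the sizes of the entries of [v]. *)
suff ann0 d (v : 'rV[{poly F}]_n) :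
    (forall j, (size (v 0%R j) <= d)%N) -> v *m P = 0 -> v = 0.
  apply/negP => /det0P[v /eqP v_neq0 vP0]; apply: v_neq0.
  by apply: (ann0 (\max_j size (v 0%R j))) vP0 => j; apply: leq_bigmax.
elim: d v => [|d IHd] v szv vP0.
  by apply/rowP => j; rewrite mxE; apply/eqP; rewrite -size_poly_leq0.
suff vU0 i : v *m Up i = 0.
  rewrite -[v]mulmx1 -(map_mx1 polyC) -sumU raddf_sum mulmx_sumr big1 //= => i _.
  by rewrite map_mxZ -scalemxAr vU0 scaler0.
apply/eqP/negP => /negP vUi.
(* Among the [U k] that do not kill [v], take the one of highest exponent. The coefficient of degree
   [d + e i] of [v *m P] then comes from [v *m Up i] alone, so [v *m Up i] loses its top term. It is
   still annihilated by [P], by commutation, and the induction hypothesis applies. *)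
case: (@arg_maxnP I i (fun k => v *m Up k != 0) e vUi) => {vUi}i vUi max_i.
case/eqP: vUi; apply: IHd; last by rewrite -mulmxA -commUp mulmxA vP0 mul0mx.
move=> j; apply/leq_sizeP => k; rewrite leq_eqVlt => /predU1P[<-|ltdk].
  have : ((v *m P) 0 j)`_(d + e i) = 0 by rewrite vP0 mxE coef0.
  rewrite mulmx_sumr summxE coef_sum (bigD1 i) //= big1 ?addr0.
    by rewrite -scalemxAr mxE coefXnM ltnNge leq_addl addnK.
  move=> i' i'i; rewrite -scalemxAr mxE coefXnM.
  case: ltnP => // le_i'; have [v0|/max_i /=] := eqVneq (v *m Up i') 0.
    by rewrite -/(Up i') v0 mxE coef0.
  rewrite leq_eqVlt (inj_eq inj_e) (negPf i'i) /= => lt_i'.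
  rewrite mxE coef_sum big1 // => l _; rewrite mxE coefMC.
  by rewrite nth_default ?mul0r // (leq_trans (szv l)) //; lia.
rewrite mxE coef_sum big1 // => l _; rewrite mxE coefMC.
by rewrite nth_default ?mul0r // (leq_trans (szv l)).
Qed.

(** * Minkowski's linear forms theorem *)

(** Among the (k+1)^n vectors with coordinates in 0..k, two are congruent modulo the row lattice of
    [A], of index |det A|; their difference is [m *m A]. *)
Lemma int_det_pigeonhole (n : nat) (A : 'M[int]_n) (k : nat) :
  \det A != 0 -> (`|\det A| < k.+1 ^ n)%N ->
  exists2 m : 'rV[int]_n, m != 0 & forall j, (`|(m *m A) 0%R j| <= k)%N.
Proof.
have [L uL [S uS [d _ ->]]] := int_Smith_normal_form A.
pose a (i : 'I_n) : int := d`_i; set D := \matrix_(i, j) _.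
have DE : D = diag_mx (\row_i a i).
  by apply/matrixP => i j; rewrite !mxE.
have abs_unit (T : 'M[int]_n) : T \in unitmx -> `|\det T|%N = 1%N.
  by rewrite unitmxE unfold_in => /orP[] /eqP->.
rewrite !det_mulmx !abszM !(abs_unit _ uL) !(abs_unit _ uS) mul1n muln1.
rewrite !mulf_eq0 !negb_or => /andP[/andP[_ detD] _] ltk.
have detDE : `|\det D|%N = (\prod_(i < n) `|a i|)%N.
  rewrite DE det_diag (big_morph absz abszM (erefl : `|1%R|%N = 1%N)).
  by apply: eq_bigr => i _; rewrite mxE.
have dn0 (i : 'I_n) : a i != 0.
  by move: detD; rewrite DE det_diag => /prodf_neq0/(_ i isT); rewrite mxE.
pose x (f : {ffun 'I_n -> 'I_k.+1}) : 'rV[int]_n := \row_j (f j : nat)%:Z.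
have modlt f (i : 'I_n) : (`|((x f *m invmx S) 0%R i %% a i)%Z| < `|a i|)%N.
  have := ltz_mod ((x f *m invmx S) 0%R i) (dn0 i).
  by have := modz_ge0 ((x f *m invmx S) 0%R i) (dn0 i); lia.
(* As A = L D S with L and S unimodular, x lies in the row lattice of A iff x S^-1 lies in that of
   D: the residues of x S^-1 modulo the diagonal entries give the class of x. *)
pose g f : {dffun forall i : 'I_n, 'I_(`|a i|)} :=
  [ffun i : 'I_n => Ordinal (modlt f i)].
have /injectivePn [f1 [f2 nef eqg]] : ~~ injectiveb g.
  apply: contraL ltk => /injectiveP inj_g; rewrite -leqNgt.
  have := leq_card g inj_g; rewrite card_ffun !card_ord card_dep_ffun.
  rewrite detDE; congr (_ <= _)%N.
  rewrite foldrE big_map big_enum /=; apply: eq_bigr => i _.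
  by rewrite card_ord.
pose y := (x f1 - x f2) *m invmx S.
have dvd_y (i : 'I_n) : (a i %| y 0%R i)%Z.
  have := congr1 (fun h : {dffun forall i : 'I_n, 'I_(`|a i|)} => (h i : nat)) eqg.
  rewrite !ffunE /= => eqmod.
  rewrite /y mulmxBl !mxE -eqz_mod_dvd; apply/eqP.
  have := modz_ge0 ((x f1 *m invmx S) 0%R i) (dn0 i).
  have := modz_ge0 ((x f2 *m invmx S) 0%R i) (dn0 i).
  by rewrite !mxE in eqmod *; lia.
pose z : 'rV[int]_n := \row_i (y 0%R i %/ a i)%Z.
have zD : z *m D = y.
  by apply/rowP => i; rewrite DE mul_mx_diag mxE [z _ _]mxE [X in _ * X]mxE divzK.
pose m := z *m invmx L.
have mA : m *m (L *m D *m S) = x f1 - x f2.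
  by rewrite !mulmxA mulmxKV // zD /y mulmxKV.
exists m => [|j].
  apply: contraNneq nef => m0; have /eqP := mA; rewrite m0 mul0mx eq_sym subr_eq0.
  move=> /eqP/rowP eqx; apply/eqP/ffunP => i; apply/val_inj.
  by have := eqx i; rewrite !mxE; case.
rewrite mA !mxE; move: (nat_of_ord (f1 j)) (nat_of_ord (f2 j)) (ltn_ord (f1 j)) (ltn_ord (f2 j)).
by move=> p q; lia.
Qed.

Lemma cvg_det (R : realType) (n : nat) (B : nat -> 'M[R]_n) (A : 'M[R]_n) :
  (forall i j, B p i j @[p --> \oo] --> A i j) ->
  \det (B p) @[p --> \oo] --> \det A.
Proof.
move=> cvgB; apply: (cvg_big add_continuous) => s _.
apply: cvgM; first exact: cvg_cst.
by apply: (cvg_big mul_continuous) => i _; apply: cvgB.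
Qed.

(** The constant comes from the entries of the inverse matrix. It serves both to control the effect
    of perturbing [A] and to confine the integer vectors with small image to a finite box. *)
Lemma row_sum_norm_bound (R : realType) (n : nat) (A : 'M[R]_n) :
  \det A != 0 ->
  exists2 C : R, 0 < C & forall (x : 'rV[R]_n) (t : R), 0 <= t ->
    (forall j, `|(x *m A) 0%R j| <= t) -> \sum_i `|x 0%R i| <= C * t.
Proof.
move=> detA; exists (1 + \sum_i \sum_j `|invmx A j i|).
  by rewrite ltr_pwDl // sumr_ge0 // => i _; rewrite sumr_ge0.
move=> x t t_ge0 xA_le; have uA : A \in unitmx by rewrite unitmxE unitfE.
rewrite mulrDl mul1r ler_wpDl // mulr_suml; apply: ler_sum => i _.
rewrite -{1}(mulmxK uA x) mxE (le_trans (ler_norm_sum _ _ _)) //.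
rewrite mulr_suml; apply: ler_sum => j _.
by rewrite normrM mulrC ler_wpM2l.
Qed.

(** Round (p+1) A down to an integer matrix, apply the pigeonhole lemma to it, and divide by p+1.
    The slack [eps] absorbs the rounding error. *)
Lemma minkowski_linear_forms_approx (R : realType) (n : nat) (A : 'M[R]_n) (c eps : R) :
  \det A != 0 -> 0 < c -> `|\det A| < c ^+ n -> 0 < eps ->
  exists2 m : 'rV[int]_n, m != 0 &
    forall j, `|(map_mx intr m *m A) 0%R j| <= c + eps.
Proof.
move=> detA c_gt0 detA_lt eps_gt0.
have [C C_gt0 Cbound] := row_sum_norm_bound detA.
pose fl p : 'M[int]_n := \matrix_(i, j) Num.floor (p.+1%:R * A i j).
pose B p : 'M[R]_n := p.+1%:R^-1 *: map_mx intr (fl p).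
have p1 (p : nat) : 0 < p.+1%:R^-1 :> R by rewrite invr_gt0 ltr0n.
have AB p i j : 0 <= A i j - B p i j <= p.+1%:R^-1.
  have /andP[fl1 fl2] := floor_itv (p.+1%:R * A i j).
  have -> : A i j - B p i j =
      p.+1%:R^-1 * (p.+1%:R * A i j - (Num.floor (p.+1%:R * A i j))%:~R).
    by rewrite !mxE mulrBr mulKf ?pnatr_eq0.
  rewrite mulr_ge0 ?subr_ge0 ?(ltW (p1 p)) //=.
  by rewrite ler_piMr ?(ltW (p1 p)) // lerBlDl -(intrD _ _ 1) ltW.
have cvgB i j : B p i j @[p --> \oo] --> A i j.
  apply: (@squeeze_cvgr _ _ _ _ (fun p => A i j - harmonic p) (fun=> A i j)).
  - near=> p; have /andP[] := AB p i j; rewrite /harmonic /= => ? ?.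
    by apply/andP; split; [rewrite lerBlDr -lerBlDl|rewrite -subr_ge0].
  - by rewrite -[X in _ --> X]subr0; apply: cvgB; [exact: cvg_cst|exact: cvg_harmonic].
  - exact: cvg_cst.
have cvgD := cvg_det cvgB.
(* The first condition keeps det (B p) nonzero, the second keeps it below c^n in absolute value. *)
have near1 : \forall p \near \oo, `|\det A - \det (B p)| < `|\det A|.
  by apply: (cvgr_dist_lt _ _ cvgD); rewrite normr_gt0.
have near2 : \forall p \near \oo, `|\det A - \det (B p)| < c ^+ n - `|\det A|.
  by apply: (cvgr_dist_lt _ _ cvgD); rewrite subr_gt0.
(* With [s] the sum of the |x_l|, the bound [e1] on 1/(p+1) will give s <= 2 C c, and [e2] then
   gives s / (p+1) <= eps. *)
have e1 : 0 < (2 * C)^-1 by rewrite invr_gt0 mulr_gt0.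
have e2 : 0 < eps / (2 * C * c) by rewrite divr_gt0 // !mulr_gt0.
have near3 := near_infty_natSinv_lt (PosNum e1).
have near4 := near_infty_natSinv_lt (PosNum e2).
have [p [near1p near2p near3p near4p]] : exists p : nat,
   [/\ `|\det A - \det (B p)| < `|\det A|,
       `|\det A - \det (B p)| < c ^+ n - `|\det A|,
       p.+1%:R^-1 < (2 * C)^-1 & p.+1%:R^-1 < eps / (2 * C * c)].
  near \oo => p; exists p; split; near: p; assumption.
have detB : \det (B p) = p.+1%:R^-1 ^+ n * (\det (fl p))%:~R.
  by rewrite detZ det_map_mx.
have detBn0 : \det (B p) != 0.
  by apply: contraTneq near1p => ->; rewrite subr0 ltxx.
have detBlt : `|\det (B p)| < c ^+ n.
  have : `|\det (B p)| <= `|\det A| + `|\det A - \det (B p)|.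
    by rewrite -{1}(subKr (\det A) (\det (B p))) ler_normB.
  lra.
pose k := Num.truncn (p.+1%:R * c).
have pc_ge0 : 0 <= p.+1%:R * c by rewrite mulr_ge0 ?ler0n // ltW.
have /andP[k_le k_gt] := truncn_itv pc_ge0.
have [||m m0 mk] := @int_det_pigeonhole n (fl p) k.
- by apply: contraNneq detBn0 => fl0; rewrite detB fl0 mulr0.
(* |det (fl p)| = (p+1)^n |det (B p)| < ((p+1) c)^n, and (p+1) c < k+1 by the choice of [k]. *)
- rewrite -(ltr_nat R) natrX natr_absz intr_norm.
  apply: (@lt_le_trans _ _ ((p.+1%:R * c) ^+ n)); last first.
    by rewrite lerXn2r ?nnegrE // ltW.
  rewrite exprMn; move: detBlt; rewrite detB normrM (gtr0_norm (exprn_gt0 _ (p1 p))).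
  by rewrite exprVn mulrC ltr_pdivrMr ?exprn_gt0 ?ltr0n // mulrC.
exists m => // j; set x := map_mx intr m.
have xB i : `|(x *m B p) 0 i| <= c.
  rewrite /B -scalemxAr -map_mxM /= mxE mxE normrM (gtr0_norm (p1 p)).
  rewrite mulrC ler_pdivrMr ?ltr0n // mulrC.
  by rewrite (le_trans _ k_le) // -intr_norm -natr_absz ler_nat.
pose s : R := \sum_l `|x 0%R l|.
have xAB i : `|(x *m (A - B p)) 0 i| <= s / p.+1%:R.
  rewrite mxE (le_trans (ler_norm_sum _ _ _)) // mulr_suml.
  apply: ler_sum => l _; rewrite normrM ler_wpM2l // [X in `|X|]mxE [X in _ + X]mxE.
  by have /andP[? ?] := AB p l i; rewrite ger0_norm.
have xA i : `|(x *m A) 0 i| <= c + s / p.+1%:R.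
  have -> : x *m A = x *m B p + x *m (A - B p) by rewrite -mulmxDr addrC subrK.
  by rewrite mxE (le_trans (ler_normD _ _)) // lerD.
have s_ge0 : 0 <= s by rewrite sumr_ge0.
(* [s] bounds itself: its coefficient C / (p+1) on the right is at most 1/2, so it can be moved to
   the left. *)
have s_le : s <= C * (c + s / p.+1%:R).
  by apply: Cbound => //; rewrite addr_ge0 ?(ltW c_gt0) ?mulr_ge0 ?(ltW (p1 p)).
have s_le2 : s <= 2 * C * c.
  have : C * (s / p.+1%:R) <= s / 2.
    rewrite mulrCA ler_wpM2l // -ler_pdivlMl // (le_trans (ltW near3p)) //.
    by rewrite invfM mulrC.
  move: s_le; rewrite mulrDr -(mulrA 2); move: (C * c) (C * (s / _)) => u v; lra.
rewrite (le_trans (xA j)) // lerD2l (@le_trans _ _ (2 * C * c / p.+1%:R)) //.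
  by rewrite ler_wpM2r // ltW.
by move: near4p; rewrite ltr_pdivlMr ?mulr_gt0 // mulrC => /ltW.
Unshelve. all: by end_near.
Qed.

(** Only finitely many integer vectors have image bounded by c + 1, so the values exceeding [c] stay
    away from it, and a small enough error in the approximate version is no error at all. *)
Lemma minkowski_linear_forms (R : realType) (n : nat) (A : 'M[R]_n) (c : R) :
  (0 < n)%N -> \det A != 0 -> 0 < c -> `|\det A| <= c ^+ n ->
  exists2 m : 'rV[int]_n, m != 0 &
    forall j, `|(map_mx intr m *m A) 0%R j| <= c.
Proof.
move=> n_gt0 detA c_gt0 detA_le; apply: contrapT => no_m.
have shift (z : int) (N : nat) : (`|z| <= N)%N ->
    (`|(z + N%:Z)%R| < N.*2.+1)%N /\ `|(z + N%:Z)%R|%N%:Z - N%:Z = z by lia.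
have [C C_gt0 Cbound] := row_sum_norm_bound detA.
pose N := Num.truncn (C * (c + 1)).
have N_gt : C * (c + 1) < N.+1%:R by apply: truncnS_gt.
(* The box of vectors with coordinates in [-N, N], shifted by [N] to be a finite type, together with
   the index of a form. *)
pose T : finType := ({ffun 'I_n -> 'I_(N.*2.+1)} * 'I_n)%type.
pose row (f : {ffun 'I_n -> 'I_(N.*2.+1)}) : 'rV[int]_n :=
  \row_i ((f i : nat)%:Z - N%:Z).
pose g (p : T) : R := `|(map_mx intr (row p.1) *m A) 0%R p.2|.
(* Half the smallest excess over [c], capped at 1 so that the box computed with c + 1 suffices. One
   half of [e] makes the determinant inequality strict, the other is the allowed error. *)
pose e : R := \big[Num.min/1]_(p | c < g p) ((g p - c) / 2).
have e_gt0 : 0 < e.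
  by apply: lt_bigmin => [|p lt_p]; [exact: ltr01 | rewrite divr_gt0 ?subr_gt0].
have e_le1 : e <= 1 by apply: bigmin_le_id.
have c2_gt0 : 0 < c + e / 2 by lra.
have detA_lt : `|\det A| < (c + e / 2) ^+ n.
  rewrite (le_lt_trans detA_le) // ltrXn2r ?gtn_eqF // ?(ltW c_gt0) //; lra.
have e2_gt0 : 0 < e / 2 by lra.
have [m m0 m_le] := minkowski_linear_forms_approx detA c2_gt0 detA_lt e2_gt0.
apply: no_m; exists m => // j; rewrite leNgt; apply/negP => m_gt.
have m_sum : \sum_i `|map_mx intr m 0%R i : R| <= C * (c + 1).
  by apply: Cbound => [|i]; [lra | rewrite (le_trans (m_le i)) //; lra].
have m_bound i : (`|m 0%R i| <= N)%N.
  rewrite -ltnS -(ltr_nat R) natr_absz intr_norm (le_lt_trans _ N_gt) //.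
  rewrite (le_trans _ m_sum) // (bigD1 i) //= mxE lerDl; apply: sumr_ge0 => l _.
  exact: (normr_ge0 (_ : R)).
have f_lt i : (`|(m 0 i + N%:Z)%R| < N.*2.+1)%N by have [] := shift _ _ (m_bound i).
pose f : {ffun 'I_n -> 'I_(N.*2.+1)} := [ffun i => Ordinal (f_lt i)].
have mE : row f = m.
  by apply/rowP => i; rewrite mxE ffunE /=; have [] := shift _ _ (m_bound i).
have : e <= (g (f, j) - c) / 2.
  by apply: bigmin_le_cond; rewrite /g /= mE.
have := m_le j; rewrite /g /= mE; lra.
Qed.

(** * Complex embeddings and discriminants *)

Lemma ex_rmorphism (A B : nzRingType) (f : A -> B) :
  zmod_morphism f -> monoid_morphism f ->
  exists s : {rmorphism A -> B}, s =1 f.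
Proof.
move=> fB fM.
pose mB := GRing.isZmodMorphism.Build A B f fB.
pose mM := GRing.isMonoidMorphism.Build A B f fM.
pose s : {rmorphism A -> B} := HB.pack f mB mM.
by exists s.
Qed.

Section Embeddings.
Variables (C : numClosedFieldType) (K : fieldExtType rat).
Local Notation n := (\dim {:K}).
Local Notation toK := (map_poly (in_alg K)).
Local Notation toC := (map_poly (ratr : rat -> C)).

Lemma rmorph_horner_rat (s : {rmorphism K -> C}) (q : {poly rat}) (x : K) :
  s (toK q).[x] = (toC q).[s x].
Proof.
rewrite -horner_map -map_poly_comp; congr _.[_]; apply: eq_map_poly => a /=.
exact: (fmorph_eq_rat (s \o in_alg K)).
Qed.

(** Primitive element theorem: an embedding is determined by the image of a generator [theta], which
    can be any of the n distinct roots of its minimal polynomial. *)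
Lemma ex_embeddings : exists (theta : K) (z : 'I_n -> C) (s : 'I_n -> {rmorphism K -> C}),
  [/\ injective z, forall i, s i theta = z i,
      forall x, exists q : {poly rat}, x = (toK q).[theta]
    & forall t : {rmorphism K -> C}, exists i, t =1 s i].
Proof.
have charK : has_pchar0 K by move=> p; rewrite pchar_lalg pchar_num.
pose theta := separable_generator 1%AS {:K}%AS.
have gen : {:K}%VS = <<1; theta>>%VS.
  apply: (@eq_adjoin_separable_generator _ _ {:K}%AS 1%AS); last exact: sub1v.
  by apply/separableP => y _; apply: pcharf0_separable; apply: charK.
have exq x : exists q : {poly rat}, x = (toK q).[theta].
  have : x \in <<1; theta>>%VS by rewrite -gen memvf.
  by case/Fadjoin_polyP => p /polyOver1P[q ->] ->; exists q.
have /polyOver1P[f fE] := minPolyOver 1%AS theta.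
have f_monic : f \is monic.
  by rewrite -(map_monic (in_alg K)) -fE monic_minPoly.
have sizef : size f = n.+1.
  rewrite -(size_map_poly (in_alg K)) -fE size_minPoly gen dim_Fadjoin.
  by rewrite dimv1 muln1.
have sepf : separable_poly f.
  by rewrite -(separable_map (in_alg K)) -fE; apply: pcharf0_separable; apply: charK.
have [r rE] := closed_field_poly_normal (toC f).
move: rE; rewrite (monicP _) ?map_monic // scale1r => rE.
have size_r : size r = n.
  by apply/succn_inj; rewrite -(size_prod_XsubC _ id) -rE size_map_poly.
have uniq_r : uniq r by rewrite -separable_prod_XsubC -rE separable_map.
pose z (i : 'I_n) := r`_i.
have fz i : root (toC f) (z i).
  by rewrite rE root_prod_XsubC mem_nth ?size_r.
have vanish q i : (toK q).[theta] = 0 -> (toC q).[z i] = 0.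
  move=> q0; have /dvdpP[u ->] : f %| q.
    rewrite -(dvdp_map (in_alg K)) -fE minPoly_dvdp //; last exact/rootP.
    by apply/polyOver1P; exists q.
  by rewrite rmorphM hornerM (rootP (fz i)) mulr0.
(* An arbitrary polynomial expression of [x] in [theta]; by [ext] its value at a root does not
   depend on the choice, which makes evaluation a ring morphism. *)
pose q x := sval (cid (exq x)).
have qE x : x = (toK (q x)).[theta] by rewrite /q; case: (cid _).
have ext i (p1 p2 : {poly rat}) : (toK p1).[theta] = (toK p2).[theta] ->
    (toC p1).[z i] = (toC p2).[z i].
  move=> p12; apply/eqP; rewrite -subr_eq0 -hornerN -hornerD -!rmorphB /=.
  by rewrite vanish // rmorphB hornerD hornerN p12 subrr.
have exs i : exists s : {rmorphism K -> C}, forall p, s (toK p).[theta] = (toC p).[z i].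
  have [||s sE] := @ex_rmorphism K C (fun x => (toC (q x)).[z i]).
  - move=> x y; rewrite -hornerN -hornerD -rmorphB /=; apply: ext.
    by rewrite rmorphB hornerD hornerN -!qE.
  - split=> [|x y].
      have -> : 1 = (toC 1).[z i] by rewrite rmorph1 hornerC.
      by apply: ext; rewrite -qE rmorph1 hornerC.
    by rewrite -hornerM -rmorphM /=; apply: ext; rewrite rmorphM hornerM -!qE.
  by exists s => p; rewrite sE; apply: ext; rewrite -qE.
pose s i := sval (cid (exs i)).
have sE i p : s i (toK p).[theta] = (toC p).[z i].
  by rewrite /s; case: (cid _) => /= t ->.
exists theta, z, s; split=> //.
- move=> i j zij; apply/val_inj/eqP.
  by move/eqP: zij; rewrite /z nth_uniq ?size_r.
- by move=> i; have := sE i 'X; rewrite !map_polyX !hornerX.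
- move=> t; have tf : root (toC f) (t theta).
    by apply/rootP; rewrite -rmorph_horner_rat -fE minPolyxx rmorph0.
  have [i ti] : exists i : 'I_n, t theta = z i.
    move: tf; rewrite rE root_prod_XsubC => tr.
    have lti : (index (t theta) r < n)%N by rewrite -size_r index_mem.
    by exists (Ordinal lti); rewrite /z /= nth_index.
  by exists i => x; rewrite (qE x) rmorph_horner_rat sE ti.
Qed.
End Embeddings.

Section Conjugates.
Variables (C : numClosedFieldType) (K : fieldExtType rat).
Local Notation n := (\dim {:K}).

Definition lincomb (w : 'I_n -> K) (c : 'rV[rat]_n) : K := \sum_k c 0%R k *: w k.

(** With n vectors in dimension n, this means being a Q-basis. *)
Definition spans (w : 'I_n -> K) : Prop := forall x, exists c, x = lincomb w c.

Lemma lincomb_mulmx (w : 'I_n -> K) (P : 'M[rat]_n) (c : 'rV[rat]_n) :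
  lincomb (fun k => lincomb w (row k P)) c = lincomb w (c *m P).
Proof.
rewrite /lincomb; under [RHS]eq_bigr do rewrite mxE scaler_suml.
rewrite exchange_big; apply: eq_bigr => k _; rewrite scaler_sumr.
by apply: eq_bigr => l _; rewrite scalerA mxE.
Qed.

Lemma spans_mulmx (w : 'I_n -> K) (P : 'M[rat]_n) :
  P \in unitmx -> spans w -> spans (fun k => lincomb w (row k P)).
Proof.
move=> uP spw x; have [c ->] := spw x; exists (c *m invmx P).
by rewrite lincomb_mulmx mulmxKV.
Qed.

Lemma spans_coords (w v : 'I_n -> K) :
  spans w -> exists P : 'M[rat]_n, forall k, v k = lincomb w (row k P).
Proof.
move=> spw; have P k := cid (spw (v k)).
exists (\matrix_k sval (P k)) => k; rewrite rowK; exact: svalP (P k).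
Qed.

Lemma lincomb_delta (w : 'I_n -> K) k : lincomb w (delta_mx 0 k) = w k.
Proof.
rewrite /lincomb (bigD1 k) //= mxE !eqxx scale1r big1 ?addr0 // => l lk.
by rewrite mxE (negPf lk) andbF scale0r.
Qed.

Lemma spans_vbasis : spans (tnth (vbasis {:K})).
Proof.
move=> x; exists (\row_i coord (vbasis {:K}) i x).
rewrite {1}(coord_vbasis (memvf x)); apply: eq_bigr => i _.
by rewrite mxE (tnth_nth 0).
Qed.

Variable s : 'I_n -> {rmorphism K -> C}.

Definition conjmx (w : 'I_n -> K) : 'M[C]_n := \matrix_(k, i) s i (w k).

Lemma rmorph_lincomb (t : {rmorphism K -> C}) w c :
  t (lincomb w c) = \sum_k ratr (c 0%R k) * t (w k).
Proof.
rewrite rmorph_sum; apply: eq_bigr => k _.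
by rewrite -mulr_algl rmorphM; congr (_ * _); apply: (fmorph_eq_rat (t \o in_alg K)).
Qed.

Lemma conjmx_mul (w : 'I_n -> K) (P : 'M[rat]_n) :
  conjmx (fun k => lincomb w (row k P)) = map_mx ratr P *m conjmx w.
Proof.
apply/matrixP => k i; rewrite !mxE rmorph_lincomb; apply: eq_bigr => l _.
by rewrite !mxE.
Qed.

Lemma conjmx_scale (w : 'I_n -> K) a :
  conjmx (fun k => a * w k) = conjmx w *m diag_mx (\row_i s i a).
Proof. by apply/matrixP => k i; rewrite mul_mx_diag !mxE rmorphM mulrC. Qed.

Hypothesis det_vbasis : \det (conjmx (tnth (vbasis {:K}))) != 0.

Lemma spans_conjmx (w : 'I_n -> K) : spans w <-> \det (conjmx w) != 0.
Proof.
split=> [spw|].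
  have [P PE] := spans_coords (tnth (vbasis {:K})) spw.
  have := det_vbasis; rewrite (_ : tnth _ = fun k => lincomb w (row k P)); last exact/funext.
  by rewrite conjmx_mul det_mulmx mulf_eq0 negb_or => /andP[].
have [P PE] := spans_coords w spans_vbasis.
rewrite (_ : w = fun k => lincomb (tnth (vbasis {:K})) (row k P)); last exact/funext.
rewrite conjmx_mul det_mulmx mulf_eq0 negb_or => /andP[detP _].
apply: spans_mulmx spans_vbasis.
by rewrite unitmxE unitfE -(fmorph_eq0 (ratr : rat -> C)) -det_map_mx.
Qed.

(** The conjugate matrix of a basis diagonalizes multiplication by [x], with eigenvalues the
    conjugates of [x]. *)
Lemma field_trace_conjugates x : ratr (field_trace x) = \sum_i s i x :> C.
Proof.
rewrite /field_trace; set e := vbasis _; set M := passmx.mxof _ _ _.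
have be : basis_of {:K} e by apply: vbasisP.
have Mrow k : x * tnth e k = lincomb (tnth e) (row k M).
  have -> : row k M = passmx.rVof e (x * tnth e k).
    by rewrite rowE passmx.mul_mxof passmx.vecof_delta lfunE /= (tnth_nth 0).
  rewrite -{1}(passmx.rVofK be (x * tnth e k)) /passmx.vecof.
  by apply: eq_bigr => i _; congr (_ *: _); rewrite (tnth_nth 0).
have ME : map_mx ratr M *m conjmx (tnth e) = conjmx (tnth e) *m diag_mx (\row_i s i x).
  by rewrite -conjmx_mul -conjmx_scale; congr conjmx; apply/funext => k; rewrite Mrow.
have ue : conjmx (tnth e) \in unitmx by rewrite unitmxE unitfE.
have -> : ratr (\tr M) = \tr (map_mx (ratr : rat -> C) M).
  by rewrite trace_map_mx.
rewrite -[map_mx _ M](mulmxK ue) ME mxtrace_mulC mulmxA mulVmx // mul1mx.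
by rewrite mxtrace_diag; apply: eq_bigr => i _; rewrite mxE.
Qed.

Lemma basis_disc_conjmx (w : n.-tuple K) :
  ratr (basis_disc w) = \det (conjmx (tnth w)) ^+ 2 :> C.
Proof.
rewrite /basis_disc -det_map_mx expr2 -{2}(det_tr (conjmx _)) -det_mulmx.
congr (\det _).
apply/matrixP => i j; rewrite !mxE /= field_trace_conjugates; apply: eq_bigr => l _.
by rewrite !mxE rmorphM.
Qed.

End Conjugates.

(** On the powers of a primitive element the conjugate matrix is Vandermonde with distinct nodes; a
    change of basis carries this to [vbasis]. *)
Lemma ex_complete_embeddings (C : numClosedFieldType) (K : fieldExtType rat) :
  exists s : 'I_(\dim {:K}) -> {rmorphism K -> C},
    [/\ forall i j, s i =1 s j -> i = j,
        forall t : {rmorphism K -> C}, exists i, t =1 s i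
      & \det (conjmx s (tnth (vbasis {:K}))) != 0].
Proof.
have [theta [z [s [inj_z s_theta _ complete]]]] := ex_embeddings C K.
exists s; split=> //.
  by move=> i j sij; apply: inj_z; rewrite -!s_theta sij.
have [P PE] := spans_coords (fun k : 'I_(\dim {:K}) => theta ^+ k) (@spans_vbasis K).
have : \det (conjmx s (fun k => theta ^+ k)) != 0.
  have -> : conjmx s (fun k => theta ^+ k) = Vandermonde _ (\row_i z i).
    by apply/matrixP => k i; rewrite !mxE rmorphXn s_theta.
  rewrite det_Vandermonde; apply/prodf_neq0 => i _; apply/prodf_neq0 => j ij.
  rewrite !mxE subr_eq0 (inj_eq inj_z); apply: contraTneq ij => ->.
  by rewrite ltnn.
rewrite (_ : (fun k => _) = fun k => lincomb (tnth (vbasis {:K})) (row k P)); last exact/funext.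
by rewrite conjmx_mul det_mulmx mulf_eq0 negb_or => /andP[].
Qed.

(** * Integral bases *)

(** The base change that replaces the i-th vector of a basis. The cofactors along row [i] are those
    of the identity matrix. *)
Lemma det_identity_with_row (F : comNzRingType) (n : nat) (i : 'I_n) (t : 'rV[F]_n) :
  \det (\matrix_(k, l) if k == i then t 0%R l else (k == l)%:R) = t 0%R i.
Proof.
set T := \matrix_(k, l) _.
have cofT j : cofactor T i j = (j == i)%:R.
  have -> : cofactor T i j = cofactor 1%:M i j.
    congr (_ * \det _); apply/matrixP => k l; rewrite !mxE.
    by rewrite eq_sym (negPf (neq_lift _ _)).
  have : \adj (1%:M : 'M[F]_n) = 1%:M by rewrite -[LHS]mul1mx mul_mx_adj det1.
  by move/matrixP/(_ j i); rewrite !mxE.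
rewrite (expand_det_row T i) (bigD1 i) //= cofT eqxx mulr1 mxE eqxx big1 ?addr0 //.
by move=> j ji; rewrite cofT (negPf ji) mulr0.
Qed.

Section Integers.
Variable K : fieldExtType rat.
Local Notation n := (\dim {:K}).
Local Notation O := (@ring_of_integers K).

Lemma ring_of_integersB x y : O x -> O y -> O (x - y).
Proof. exact: integral_sub. Qed.

Lemma ring_of_integersM x y : O x -> O y -> O (x * y).
Proof. exact: integral_mul. Qed.

Lemma ring_of_integers_int (z : int) : O z%:~R.
Proof. exact: (integral_id (intr : {rmorphism int -> K})). Qed.

Lemma rat_integral (q : rat) :
  integralOver (intr : int -> algC) (ratr q) -> exists z : int, q = z%:~R.
Proof.
case=> p p_monic pq; have qA : (ratr q : algC) \in Aint.
  apply: (root_monic_Aint pq); first exact: monic_map.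
  by apply/polyOverP => i; rewrite coef_map /= intr_int.
have qR : (ratr q : algC) \in Crat by apply/CratP; exists q.
have /intrP[z qz] := Cint_rat_Aint qR qA.
by exists z; apply: (fmorph_inj (ratr : {rmorphism rat -> algC})); rewrite rmorph_int.
Qed.

(** The trace is a sum of conjugates, all integral, and a rational algebraic integer is an
    integer. *)
Lemma field_trace_int x : O x -> exists z : int, field_trace x = z%:~R.
Proof.
move=> Ox; apply: rat_integral.
have [s [_ _ dets]] := ex_complete_embeddings algC K.
rewrite (field_trace_conjugates dets).
apply: (big_ind (integralOver (intr : int -> algC))) => [|a b|i _].
- exact: mxpoly.integral0.
- exact: integral_add.
have := integral_rmorph (s i) Ox; case=> p p_monic ps; exists p => //.
by move: ps; congr root; apply: eq_map_poly => a /=; rewrite rmorph_int.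
Qed.

Lemma det_conjmx_sqr_int (s : 'I_n -> {rmorphism K -> algC}) (w : 'I_n -> K) :
  \det (conjmx s (tnth (vbasis {:K}))) != 0 -> (forall k, O (w k)) ->
  exists z : int, \det (conjmx s w) ^+ 2 = z%:~R.
Proof.
move=> dets Ow; have tr k l := cid (field_trace_int (ring_of_integersM (Ow k) (Ow l))).
exists (\det (\matrix_(k, l) sval (tr k l))).
rewrite -det_map_mx expr2 -{2}(det_tr (conjmx _ _)) -det_mulmx; congr (\det _).
apply/matrixP => k l; rewrite !mxE; case: (tr k l) => z /= zE.
transitivity (ratr (field_trace (w k * w l)) : algC); last by rewrite zE ratr_int.
rewrite (field_trace_conjugates dets); by apply: eq_bigr => i _; rewrite !mxE rmorphM.
Qed.

Section Lattice.
Variable L : set K.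
Hypothesis LB : forall x y, L x -> L y -> L (x - y).

Lemma subgroupMz x (z : int) : L x -> L (x *~ z).
Proof.
move=> Lx; have L0 : L 0 by rewrite -(subrr x); apply: LB.
have LN y : L y -> L (- y) by rewrite -sub0r; apply: LB.
have Ln m : L (x *+ m).
  by elim: m => // m IH; rewrite mulrSr -[X in _ + X]opprK; apply: LB => //; apply: LN.
by case: z => m; [|rewrite NegzE mulrNz; apply: LN]; apply: Ln.
Qed.

(* A family of vectors of L of minimal nonzero discriminant generates L: an
   element with a non-integral coordinate could replace one of them and
   multiply the discriminant by the square of a fractional part. *)
Lemma lattice_basis :
  L `<=` O -> (exists2 w : 'I_n -> K, forall k, L (w k) & spans w) ->
  exists w : 'I_n -> K, [/\ forall k, L (w k), spans w &
    forall x, L x -> exists c : 'rV[int]_n, x = \sum_k w k *~ c 0%R k].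
Proof.
move=> LO [w0 Lw0 spw0].
have [s [_ _ dets]] := ex_complete_embeddings algC K.
pose P (m : nat) := `[< exists (w : 'I_n -> K) (z : int), [/\ forall k, L (w k), spans w,
  \det (conjmx s w) ^+ 2 = z%:~R & `|z|%N = m] >].
have exP : exists m, P m.
  have [z zE] := det_conjmx_sqr_int dets (fun k => LO _ (Lw0 k)).
  by exists `|z|%N; apply/asboolP; exists w0, z.
case: (ex_minnP exP) => _ /asboolP[w [z [Lw spw wz <-]]] z_min.
exists w; split=> // x Lx; have [c xc] := spw x.
suff c_int k : c 0 k = (Num.floor (c 0 k))%:~R.
  exists (\row_k Num.floor (c 0 k)); rewrite xc; apply: eq_bigr => k _.
  by rewrite mxE {1}c_int scaler_int.
apply/eqP/negPn/negP => c_frac.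
pose t := c 0 k - (Num.floor (c 0 k))%:~R.
have t_gt0 : 0 < t.
  by rewrite subr_gt0 lt_neqAle eq_sym c_frac floor_le.
have t_lt1 : t < 1 by rewrite ltrBlDl -(intrD _ _ 1) floorD1_gt.
(* The coordinates of x - floor(c_k) w_k, a vector of [L] whose k-th coordinate is the fractional
   part [t]; [T] puts it in place of w_k. *)
pose d := c - (Num.floor (c 0 k))%:~R *: delta_mx 0 k.
pose T : 'M[rat]_n := \matrix_(j, l) if j == k then d 0%R l else (j == l)%:R.
pose w' j := lincomb w (row j T).
have detT : \det T = t by rewrite det_identity_with_row !mxE !eqxx mulr1.
have w'k : w' k = x - w k *~ Num.floor (c 0 k).
  have -> : w' k = lincomb w d by congr lincomb; apply/rowP => l; rewrite !mxE eqxx.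
  rewrite xc -scaler_int -[w k in RHS]lincomb_delta /lincomb scaler_sumr -sumrB.
  by apply: eq_bigr => l _; rewrite !mxE scalerBl scalerA.
have w'j j : j != k -> w' j = w j.
  move=> jk; rewrite -[RHS]lincomb_delta; congr lincomb; apply/rowP => l.
  by rewrite !mxE (negPf jk) eqxx eq_sym.
have Lw' j : L (w' j).
  by have [->|/w'j->//] := eqVneq j k; rewrite w'k; apply/LB/subgroupMz.
have [z' z'E] := det_conjmx_sqr_int dets (fun k => LO _ (Lw' k)).
have z'z : z'%:~R = t ^+ 2 * z%:~R :> rat.
  apply: (fmorph_inj (ratr : {rmorphism rat -> algC})).
  rewrite rmorphM rmorphXn !rmorph_int -z'E -wz conjmx_mul det_mulmx exprMn.
  by rewrite det_map_mx detT.
have spw' : spans w'.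
  by apply: spans_mulmx => //; rewrite unitmxE detT unitfE gt_eqF.
have z0 : z != 0.
  rewrite -(intr_eq0 algC) -wz expf_neq0 //.
  exact/(spans_conjmx dets).
have := z_min `|z'|%N; rewrite leqNgt => /(_ _)/negP[]; last first.
  rewrite -(ltr_nat rat) !natr_absz !intr_norm z'z normrM ger0_norm ?sqr_ge0 //.
  by rewrite gtr_pMl ?normr_gt0 ?intr_eq0 // expr_lt1 // ltW.
by apply/asboolP; exists w', z'.
Qed.

End Lattice.
End Integers.

Section Bases.
Variable K : fieldExtType rat.
Local Notation n := (\dim {:K}).
Local Notation O := (@ring_of_integers K).

Lemma lincomb_inj (w : 'I_n -> K) : spans w -> injective (lincomb w).
Proof.
move=> spw; have [s [_ _ dets]] := ex_complete_embeddings algC K.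
have uw : conjmx s w \in unitmx by rewrite unitmxE unitfE; apply/(spans_conjmx dets).
move=> c d cd; apply: (@map_mx_inj _ _ (ratr : {rmorphism rat -> algC})).
rewrite -[LHS](mulmxK uw) -[RHS](mulmxK uw); congr (_ *m _); apply/rowP => i.
have := congr1 (s i) cd; rewrite !rmorph_lincomb => E; rewrite !mxE.
by under eq_bigr do rewrite !mxE; under [RHS]eq_bigr do rewrite !mxE.
Qed.

Lemma spans_scale (w : 'I_n -> K) a : a != 0 -> spans w -> spans (fun k => a * w k).
Proof.
move=> a0 spw x; have [c xc] := spw (a^-1 * x); exists c.
rewrite -[x](mulVKf a0) xc mulr_sumr; apply: eq_bigr => k _.
by rewrite scalerAr.
Qed.

Lemma lincombZ (w : 'I_n -> K) a c : lincomb w (a *: c) = a *: lincomb w c.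
Proof. by rewrite /lincomb scaler_sumr; apply: eq_bigr => k _; rewrite mxE scalerA. Qed.

Lemma lincomb_int (w : 'I_n -> K) (c : 'rV[int]_n) :
  lincomb w (map_mx intr c) = \sum_k w k *~ c 0 k.
Proof. by apply: eq_bigr => k _; rewrite mxE scaler_int. Qed.

Lemma common_denominator (I : finType) (f : I -> rat) :
  exists2 m : int, m != 0 & exists g : I -> int, forall i, m%:~R * f i = (g i)%:~R.
Proof.
exists (\prod_i denq (f i)); first by apply/prodf_neq0 => i _; apply: denq_neq0.
exists (fun i => numq (f i) * \prod_(j | j != i) denq (f j)) => i.
by rewrite (bigD1 i) //= !rmorphM /= mulrAC numqE [X in X * _]mulrC.
Qed.

(** If m clears the denominators of the matrix of multiplication by [x], then m x is an eigenvalue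
    of an integer matrix, hence a root of its monic characteristic polynomial. *)
Lemma multiple_integral (x : K) : exists2 m : int, m != 0 & O (m%:~R * x).
Proof.
pose e := tnth (vbasis {:K}); have spe : spans e := @spans_vbasis K.
have [M ME] := spans_coords (fun k => x * e k) spe.
have [m m0 [g gE]] := common_denominator (fun p : 'I_n * 'I_n => M p.1 p.2).
(* Transposed, because eigenvectors are row vectors: the row of basis elements is the
   eigenvector. *)
exists m => //; pose A : 'M[int]_n := \matrix_(i, j) g (j, i).
exists (char_poly A); first exact: char_poly_monic.
rewrite map_char_poly -eigenvalue_root_char; apply/eigenvalueP.
exists (\row_k e k).
  apply/rowP => k; rewrite !mxE -mulrA ME /lincomb mulr_sumr; apply: eq_bigr => l _.
  rewrite !mxE mulrzr -scaler_int -(gE (k, l)) /= -scalerA scaler_int.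
  by rewrite mulrzl.
apply/eqP => /rowP e0; have [c] := spe 1; rewrite /lincomb big1 => [/eqP|k _].
  by rewrite oner_eq0.
by have := e0 k; rewrite !mxE => ->; rewrite scaler0.
Qed.

Lemma ex_integral_basis : exists w : n.-tuple K, integral_basis w /\ spans (tnth w).
Proof.
have e k := cid2 (multiple_integral (tnth (vbasis {:K}) k)).
have [||w [Ow spw wO]] := @lattice_basis K O (@ring_of_integersB K).
- by [].
- pose P : 'M[rat]_n := diag_mx (\row_k (sval (e k))%:~R).
  exists (fun k => lincomb (tnth (vbasis {:K})) (row k P)) => [k|].
    have -> : row k P = (sval (e k))%:~R *: delta_mx 0 k.
      by apply/rowP => l; rewrite !mxE eqxx /= mulr_natr eq_sym.
    by rewrite lincombZ lincomb_delta scaler_int -mulrzl; case: (e k).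
  apply: spans_mulmx; last exact: spans_vbasis.
  rewrite unitmxE unitfE det_diag; apply/prodf_neq0 => k _.
  by rewrite mxE intr_eq0; case: (e k).
exists [tuple w k | k < n]; have tE : tnth [tuple w k | k < n] = w.
  by apply/funext => k; rewrite tnth_mktuple.
rewrite /integral_basis !tE; split=> //; split=> // x Ox.
have [c xc] := wO x Ox; exists [ffun k => c 0 k]; split=> [|c' xc'].
  by rewrite xc; apply: eq_bigr => k _; rewrite ffunE.
have : lincomb w (map_mx intr c) = lincomb w (map_mx intr (\row_k c' k)).
  by rewrite !lincomb_int -xc xc'; apply: eq_bigr => k _; rewrite mxE.
move/(lincomb_inj spw) => E; apply/ffunP => k; rewrite ffunE.
by have /rowP/(_ k) := E; rewrite !mxE => /intr_inj.
Qed.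

Lemma ex_field_disc : exists w : n.-tuple K,
  [/\ integral_basis w, spans (tnth w) & field_disc K = basis_disc w].
Proof.
have [w0 [w0b _]] := ex_integral_basis.
have [w wb dw] : [set basis_disc w | w in @integral_basis K] (field_disc K).
  (* An integral basis exists, so the default value 0 is not what [xget] falls back on. *)
  by apply: (@xgetPex _ 0); exists (basis_disc w0), w0.
exists w; split=> // x; have [m m0 Omx] := multiple_integral x.
have [_ /(_ _ Omx)[c [mxc _]]] := wb.
exists (m%:~R^-1 *: map_mx intr (\row_k c k)).
have -> : x = m%:~R^-1 *: (m%:~R * x).
  rewrite mulrzl -scaler_int scalerA mulVf ?scale1r //.
  by rewrite intr_eq0.
by rewrite lincombZ lincomb_int mxc; congr (_ *: _); apply: eq_bigr => k _; rewrite mxE.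
Qed.

(** Clear denominators by [d], take a basis of the lattice d J inside O, and divide it by [d]. *)
Lemma ex_ideal_basis (J : set K) : fractional_ideal J ->
  exists j : 'I_n -> K, [/\ forall k, J (j k), spans j &
    forall x, J x -> exists c : 'rV[int]_n, x = \sum_k j k *~ c 0 k].
Proof.
case=> J0 JD JM [x0 Jx0 x0n0] [d [Od d0 dJ]].
have [w0 [[Ow0 _] spw0]] := ex_integral_basis.
have JN x : J x -> J (- x).
  by rewrite -mulN1r; apply: JM; have := @ring_of_integers_int K (-1).
have [|||w [Lw spw wL]] := @lattice_basis K [set d * x | x in J].
- move=> _ _ [x Jx <-] [y Jy <-]; exists (x - y); last by rewrite mulrBr.
  by apply/JD/JN.
- by move=> _ [x Jx <-]; apply: dJ.
- exists (fun k => d * (x0 * tnth w0 k)) => [k|].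
    by exists (x0 * tnth w0 k) => //; rewrite mulrC; apply: JM.
  by apply: (spans_scale d0); apply: (spans_scale x0n0).
exists (fun k => d^-1 * w k); split.
- by move=> k; have [x Jx <-] := Lw k; rewrite mulKf.
- by apply: spans_scale; rewrite ?invr_eq0.
- move=> x Jx; have [c dxc] := wL (d * x) (ex_intro2 _ _ x Jx erefl).
  exists c; rewrite -[x](mulKf d0) dxc mulr_sumr.
  by apply: eq_bigr => k _; rewrite mulrzAr.
Qed.

End Bases.

(** * The covolume of an ideal with principal square *)

(** The exponents are a parameter so that f(X), f(X^n) and their product, indexed by pairs, all have
    this shape. *)
Definition pencil (R : comNzRingType) (n : nat) (I : finType) (e : I -> nat)
    (G : I -> 'M[R]_n) : 'M[{poly R}]_n :=
  \sum_i 'X^(e i) *: map_mx polyC (G i).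

Lemma map_pencil (R S : comNzRingType) (f : {rmorphism R -> S}) n (I : finType)
    (e : I -> nat) (G : I -> 'M[R]_n) :
  map_mx (map_poly f) (pencil e G) = pencil e (fun i => map_mx f (G i)).
Proof.
rewrite /pencil map_mx_sum; apply: eq_bigr => i _; apply/matrixP => k l.
by rewrite !mxE /= rmorphM /= map_polyXn map_polyC.
Qed.

Lemma mul_pencil (R : comNzRingType) n (I J : finType) (e : I -> nat) (e' : J -> nat)
    (G : I -> 'M[R]_n) (G' : J -> 'M[R]_n) :
  pencil e G *m pencil e' G' =
  pencil (fun p : I * J => e p.1 + e' p.2)%N (fun p => G p.1 *m G' p.2).
Proof.
rewrite /pencil mulmx_suml -(pair_big predT predT
  (fun i j => 'X^(e i + e' j) *: map_mx polyC (G i *m G' j))) /=.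
apply: eq_bigr => i _; rewrite mulmx_sumr; apply: eq_bigr => j _.
by rewrite -scalemxAl -scalemxAr scalerA -exprD map_mxM.
Qed.

Lemma pencil_mulmx (R : comNzRingType) n (I : finType) (e : I -> nat)
    (G : I -> 'M[R]_n) (M N : 'M[R]_n) :
  map_mx polyC M *m pencil e G *m map_mx polyC N =
  pencil e (fun i => M *m G i *m N).
Proof.
rewrite /pencil mulmx_sumr mulmx_suml; apply: eq_bigr => i _.
by rewrite -scalemxAr -scalemxAl -!map_mxM.
Qed.

Lemma pencil_comp_Xn (R : comNzRingType) n m (I : finType) (e : I -> nat)
    (G : I -> 'M[R]_n) :
  map_mx (comp_poly 'X^m) (pencil e G) = pencil (fun i => m * e i)%N G.
Proof.
rewrite /pencil map_mx_sum; apply: eq_bigr => i _; apply/matrixP => k l.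
by rewrite !mxE /= comp_polyM comp_polyC comp_Xn_poly exprM.
Qed.

(* With the polynomials PA = \sum_i X^i A_i and PB = \sum_k X^(nk) B_k, the
   matrix PA PB has nonzero determinant modulo every prime, whereas
   det PB = (det M ^ 2 * det N) (det PA)(X^n): hence no prime can divide the
   numerator of det M ^ 2 * det N. *)
Lemma int_factorization_det_le1 (n : nat) (A B : 'I_n -> 'M[int]_n)
    (F : 'I_n -> 'M[rat]_n) (M N : 'M[rat]_n) (c : 'I_n * 'I_n -> int) :
  (forall i, map_mx intr (A i) *m M = F i) ->
  (forall k, map_mx intr (B k) = M *m F k *m N) ->
  (forall p q, (A p.1 *m B p.2) *m (A q.1 *m B q.2) =
               (A q.1 *m B q.2) *m (A p.1 *m B p.2)) ->
  \sum_p c p *: (A p.1 *m B p.2) = 1%:M ->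
  `|\det M ^+ 2 * \det N| <= 1.
Proof.
move=> AF BF comm sum1; set r := _ * _.
pose PA := pencil (fun i : 'I_n => i : nat) A.
pose PB := pencil (fun k : 'I_n => n * k)%N B.
(* Over the rationals, PB(X) = M (PA M)(X^n) N. *)
have detPAB : \det (map_mx (map_poly intr) PB) =
    r%:P * (\det (map_mx (map_poly intr) PA) \Po 'X^n) :> {poly rat}.
  have -> : map_mx (map_poly intr) PB = map_mx polyC M *m
      map_mx (comp_poly 'X^n) (map_mx (map_poly intr) PA *m map_mx polyC M) *m
      map_mx polyC N.
    have PAM : map_mx (map_poly intr) PA *m map_mx polyC M = pencil (fun i : 'I_n => i : nat) F.
      rewrite map_pencil -[X in X *m _]mul1mx -(map_mx1 polyC) pencil_mulmx.
      by congr pencil; apply/funext => i; rewrite mul1mx AF.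
    rewrite PAM pencil_comp_Xn pencil_mulmx map_pencil.
    by congr pencil; apply/funext => k; rewrite BF.
  rewrite !det_mulmx !det_map_mx !det_mulmx !det_map_mx /= comp_polyM comp_polyC.
  by rewrite /r expr2 !polyCM; ring.
have detPABz : (denq r)%:P * \det PB = (numq r)%:P * (\det PA \Po 'X^n).
  apply: (map_inj_poly (intr_inj : injective (intr : int -> rat))) => //.
  rewrite !rmorphM /= !map_polyC /= map_comp_poly /= map_polyXn.
  rewrite -[map_poly _ (\det PB)]det_map_mx -[map_poly _ (\det PA)]det_map_mx.
  by rewrite detPAB numqE (polyCM r) /=; ring.
(* [p.1] and [p.2] are the digits of the exponent in base n. *)
have inj_e : injective (fun p : 'I_n * 'I_n => p.1 + n * p.2)%N.
  move=> [i k] [i' k'] /= E.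
  have n_gt0 : (0 < n)%N by apply: leq_ltn_trans (ltn_ord i).
  have ei : i = i' :> nat.
    have modE (a b : 'I_n) : ((a + n * b) %% n = a)%N.
      by rewrite addnC mulnC modnMDl modn_small.
    by rewrite -(modE i k) E modE.
  move: E; rewrite ei => /addnI/eqP; rewrite eqn_pmul2l // => /eqP ek.
  by congr pair; apply/val_inj.
rewrite leNgt; apply/negP => r_gt1.
have num_gt1 : (1 < `|numq r|)%N.
  rewrite -(ltr_nat rat) natr_absz intr_norm numqE normrM.
  apply: (lt_le_trans r_gt1); rewrite ler_peMr // -intr_norm ler1z.
  by have := denq_neq0 r; lia.
(* [p] divides the numerator of [r] and so not its denominator; [detPABz] then forces det PB = 0
   modulo [p], against the nonvanishing of det (PA PB). *)
have p_prime := pdiv_prime num_gt1; set p := pdiv _ in p_prime.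
have p_dvd : (p %| `|numq r|)%N := pdiv_dvd _.
pose f := (intr : {rmorphism int -> 'F_p}).
have f_eq0 (z : int) : (f z == 0) = (p %| `|z|)%N.
  rewrite /f /= (dvdn_pcharf (pchar_Fp p_prime)).
  by case: z => m //=; rewrite NegzE mulrNz oppr_eq0.
have := congr1 (map_poly f) detPABz.
rewrite !rmorphM /= !map_polyC /=.
have -> : (numq r)%:~R = 0 :> 'F_p by apply/eqP; rewrite f_eq0.
rewrite mul0r => /eqP; rewrite mulf_eq0 polyC_eq0 => /orP[|].
  rewrite f_eq0 => p_dvd_den; have := coprime_num_den r.
  move/eqP => cop; have : (p %| 1)%N by rewrite -cop dvdn_gcd p_dvd.
  by rewrite dvdn1 => /eqP p1; rewrite p1 in p_prime.
rewrite -det_map_mx => detPB0.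
have := @det_commuting_pencil_neq0 'F_p n ('I_n * 'I_n)%type _
  (fun q => map_mx f (A q.1 *m B q.2)) (fun q => f (c q)) inj_e.
have -> : \sum_(q : 'I_n * 'I_n) 'X^(q.1 + n * q.2) *: map_mx polyC (map_mx f (A q.1 *m B q.2))
    = map_mx (map_poly f) (PA *m PB).
  by rewrite mul_pencil map_pencil.
rewrite map_mxM det_mulmx (eqP detPB0) mulr0 eqxx => /(_ _ _)/negP; apply=> //.
  by move=> q q'; rewrite -!map_mxM comm.
by rewrite -(map_mx1 f) -sum1 map_mx_sum; apply: eq_bigr => q _; rewrite map_mxZ.
Qed.

Section IdealSquare.
Variable K : fieldExtType rat.
Local Notation n := (\dim {:K}).
Local Notation O := (@ring_of_integers K).

Lemma mulr_lincomb a (w : 'I_n -> K) c :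
  a * lincomb w c = lincomb (fun k => a * w k) c.
Proof. by rewrite /lincomb mulr_sumr; apply: eq_bigr => k _; rewrite scalerAr. Qed.

Lemma lincomb_sum (I : finType) (w : 'I_n -> K) (c : I -> 'rV[rat]_n) :
  lincomb w (\sum_i c i) = \sum_i lincomb w (c i).
Proof.
rewrite /lincomb exchange_big; apply: eq_bigr => k _.
by rewrite summxE scaler_suml.
Qed.

Lemma lincomb_row_inj (w : 'I_n -> K) (P Q : 'M[rat]_n) : spans w ->
  (forall k, lincomb w (row k P) = lincomb w (row k Q)) -> P = Q.
Proof. by move=> spw E; apply/row_matrixP => k; apply: (lincomb_inj spw). Qed.

Variables (J : set K) (alpha : K) (w : n.-tuple K) (j : 'I_n -> K).
Variables (M N : 'M[rat]_n).
Hypotheses (J_ideal : fractional_ideal J) (alpha_neq0 : alpha != 0).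
Hypothesis (JJ : ideal_mul J J = principal_ideal alpha).
Hypotheses (w_basis : integral_basis w) (w_spans : spans (tnth w)).
Hypotheses (Jj : forall k, J (j k)) (j_spans : spans j).
Hypothesis j_basis : forall x, J x -> exists c : 'rV[int]_n, x = \sum_k j k *~ c 0 k.
Hypothesis ME : forall k, j k = lincomb (tnth w) (row k M).
Hypothesis NE : forall k, alpha^-1 * tnth w k = lincomb (tnth w) (row k N).

Lemma ideal_prod_div x y : J x -> J y -> O (x * y / alpha).
Proof.
move=> Jx Jy; have : ideal_mul J J (x * y).
  exists [:: (x, y)]; last by rewrite big_seq1.
  by move=> p; rewrite inE => /eqP ->.
by rewrite JJ => -[z Oz <-]; rewrite mulrC mulKf.
Qed.

Lemma integral_coords (a : 'I_n -> K) (v : 'I_n -> K) (L : set K) :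
  (forall k, L (a k)) ->
  (forall x, L x -> exists c : 'rV[int]_n, x = \sum_k v k *~ c 0 k) ->
  exists P : 'M[int]_n, forall k, a k = lincomb v (row k (map_mx intr P)).
Proof.
move=> La Lv; have P k := cid (Lv _ (La k)).
exists (\matrix_k sval (P k)) => k.
by rewrite -map_row rowK lincomb_int; apply: svalP (P k).
Qed.

(** |det M| is the norm of J and det N that of 1/alpha, so this is one half of N(J)^2 = |N(alpha)|.
    With [R a] the matrix of multiplication by a, the factorization A_i M = R(j_i) is integral
    because O J lies in J, and B_k = M R(j_k) N because J J lies in alpha O. The products A_i B_k =
    R(j_i j_k / alpha) commute, and combine to the identity because alpha lies in J J. *)
Lemma ideal_square_covolume : `|\det M ^+ 2 * \det N| <= 1.
Proof.
have [_ _ JM _ _] := J_ideal; have [Ow wO] := w_basis.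
have {wO} w_int x : O x -> exists c : 'rV[int]_n, x = \sum_k tnth w k *~ c 0 k.
  move=> /wO[c [-> _]]; exists (\row_k c k).
  by apply: eq_bigr => k _; rewrite mxE.
pose R a := sval (cid (spans_coords (fun k => a * tnth w k) w_spans)).
have RE a k : a * tnth w k = lincomb (tnth w) (row k (R a)).
  by rewrite /R; case: (cid _) => /= P ->.
have R_uniq a P : (forall k, a * tnth w k = lincomb (tnth w) (row k P)) -> P = R a.
  by move=> aP; apply: (lincomb_row_inj w_spans) => k; rewrite -aP RE.
have RM a b : R (a * b) = R b *m R a.
  apply/esym/R_uniq => k; rewrite row_mul -lincomb_mulmx -mulrA RE mulr_lincomb.
  by congr lincomb; apply/funext => l; rewrite RE.
have RN : N = R alpha^-1 by apply: R_uniq.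
have exA i : exists P : 'M[int]_n, map_mx intr P *m M = R (j i).
  have [|P PE] := @integral_coords (fun k => j i * tnth w k) j J _ j_basis.
    by move=> k; rewrite mulrC; apply: JM.
  exists P; apply: R_uniq => k; rewrite PE row_mul -lincomb_mulmx.
  by congr lincomb; apply/funext => l; rewrite ME.
have exB i : exists P : 'M[int]_n, map_mx intr P = M *m R (j i) *m N.
  have [|P PE] := @integral_coords (fun k => j k * j i / alpha) (tnth w) O _ w_int.
    by move=> k; apply: ideal_prod_div.
  exists P; apply: (lincomb_row_inj w_spans) => k; rewrite -PE RN -mulmxA -RM.
  rewrite row_mul -lincomb_mulmx; transitivity (alpha^-1 * j i * j k); first by ring.
  rewrite [in LHS](ME k) mulr_lincomb; congr lincomb; apply/funext => l.
  by rewrite RE.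
pose A i := sval (cid (exA i)); pose B i := sval (cid (exB i)).
have AE i : map_mx intr (A i) *m M = R (j i) by rewrite /A; case: (cid _).
have BE i : map_mx intr (B i) = M *m R (j i) *m N by rewrite /B; case: (cid _).
have ABE p : map_mx intr (A p.1 *m B p.2) = R (j p.1 * j p.2 / alpha).
  by rewrite map_mxM BE !mulmxA AE RN -!RM; congr R; ring.
have intr_mx_inj : injective (map_mx (intr : int -> rat) : 'M[int]_n -> 'M[rat]_n).
  move=> P Q /matrixP PQ; apply/matrixP => k l.
  by have := PQ k l; rewrite !mxE => /intr_inj.
have [sq sqJ alphaE] : ideal_mul J J alpha.
  by rewrite JJ; exists 1; [exact: (ring_of_integers_int K 1) | rewrite mulr1].
have [c cE] : exists c : 'I_n * 'I_n -> int, \sum_p j p.1 * j p.2 *~ c p = alpha.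
  rewrite alphaE; elim: sq sqJ {alphaE} => [|xy sq IH] sqJ.
    exists (fun=> 0); rewrite big_nil big1 // => p _; exact: mulr0z.
  have [p sqp|c cE] := IH; first by apply: sqJ; rewrite inE sqp orbT.
  have [Jx Jy] := sqJ xy (mem_head _ _).
  have [cx xE] := j_basis Jx; have [cy yE] := j_basis Jy.
  exists (fun p => cx 0 p.1 * cy 0 p.2 + c p); rewrite big_cons -cE /= xE yE.
  under eq_bigr do rewrite mulrzDr; rewrite big_split /=; congr (_ + _).
  rewrite mulr_suml -(pair_big predT predT
    (fun k l => j k * j l *~ (cx 0 k * cy 0 l))) /=.
  apply: eq_bigr => k _; rewrite mulr_sumr; apply: eq_bigr => l _.
  by rewrite mulrzAl mulrzAr -mulrzA (mulrC (cy 0 l)).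
apply: (@int_factorization_det_le1 n A B (fun i => R (j i)) M N c) => // [p q|].
  by apply: intr_mx_inj; rewrite map_mxM [RHS]map_mxM !ABE -!RM mulrC.
apply: intr_mx_inj; rewrite map_mx1 map_mx_sum.
transitivity (R 1); last first.
  by apply/esym/R_uniq => k; rewrite mul1r row1 lincomb_delta.
apply: R_uniq => k; rewrite raddf_sum lincomb_sum -(mulfV alpha_neq0).
rewrite -{1}cE !mulr_suml.
apply: eq_bigr => p _; rewrite map_mxZ ABE /= linearZ /= lincombZ -RE scaler_int.
by rewrite !mulrzAl.
Qed.

End IdealSquare.

(** * Real linear forms *)

Section RealForms.
Variables (R : realType) (K : fieldExtType rat).
Local Notation n := (\dim {:K}).
Local Notation C := R[i].
Local Notation toC := (real_complex R).
Variable s : 'I_n -> {rmorphism K -> C}.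
Hypothesis s_inj : forall i k, s i =1 s k -> i = k.
Hypothesis s_complete : forall t : {rmorphism K -> C}, exists i, t =1 s i.
Hypothesis det_s : \det (conjmx s (tnth (vbasis {:K}))) != 0.

Lemma ex_conj_perm : exists p : {perm 'I_n}, forall i x, s (p i) x = (s i x)^*%C.
Proof.
have ex i : exists k, forall x, s k x = (s i x)^*%C.
  have [k kE] := s_complete ((conjc : {rmorphism C -> C}) \o s i).
  by exists k => x; rewrite -kE.
pose f i := sval (cid (ex i)).
have fE i x : s (f i) x = (s i x)^*%C by rewrite /f; case: (cid _).
have f_inj : injective f.
  move=> i k fik; apply: s_inj => x; apply: (can_inj (@conjcK R)).
  by rewrite -!fE fik.
by exists (perm f_inj) => i x; rewrite permE fE.
Qed.

(* In the coordinates Re + Im of all the embeddings, a conjugate pair gives the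
   forms Re + Im and Re - Im: the box |Re +- Im| <= t lies in the disc |z| <= t,
   and no choice of one embedding per pair is needed. *)
Definition real_form (z : R[i]) : R := complex.Re z + complex.Im z.

Definition formmx (w : 'I_n -> K) : 'M[R]_n := \matrix_(k, i) real_form (s i (w k)).

(** The difference [T i] of the two terms changes sign when the embedding is conjugated, and
    conjugation permutes the embeddings, so the sum of the [T i] is its own opposite. *)
Lemma real_form_gram x y :
  (\sum_i real_form (s i x) * real_form (s i y))%:C%C = \sum_i s i x * (s i y)^*%C.
Proof.
have [p pE] := ex_conj_perm.
pose T i := s i x * (s i y)^*%C - (real_form (s i x) * real_form (s i y))%:C%C.
suff T0 : \sum_i T i = 0.
  by apply/esym/eqP; rewrite -subr_eq0 rmorph_sum -sumrB; apply/eqP.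
have TN : \sum_i T i = - \sum_i T i.
  rewrite {1}(reindex_inj (@perm_inj _ p)) -sumrN; apply: eq_bigr => i _.
  rewrite /T !pE /real_form; case: (s i x) => a b; case: (s i y) => a' b'.
  by simpc; apply/eqP; rewrite eq_complex /=; apply/andP; split; apply/eqP; ring.
have : (\sum_i T i) *+ 2 == 0 by rewrite mulr2n {1}TN addNr.
by rewrite mulrn_eq0 => /eqP.
Qed.

(** With F the real and E the complex matrix, F F^T = E P E^T for the permutation matrix P of
    complex conjugation; det P is a sign. *)
Lemma det_formmx_sqr (w : n.-tuple K) :
  \det (formmx (tnth w)) ^+ 2 = `|ratr (basis_disc w)|.
Proof.
have [p pE] := ex_conj_perm.
have gram : map_mx toC (formmx (tnth w) *m (formmx (tnth w))^T) =
    conjmx s (tnth w) *m (perm_mx p *m (conjmx s (tnth w))^T).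
  apply/matrixP => k l; rewrite mxE mxE.
  under eq_bigr do rewrite !mxE.
  rewrite real_form_gram -row_permE mxE; apply: eq_bigr => i _.
  by rewrite !mxE pE.
have := congr1 determinant gram.
rewrite det_map_mx !det_mulmx !det_tr det_perm -expr2 mulrCA -expr2.
rewrite -(basis_disc_conjmx det_s) => E.
have : \det (formmx (tnth w)) ^+ 2 = (-1) ^+ p * ratr (basis_disc w).
  apply: (@complexI R); rewrite /= E rmorphM rmorphXn rmorphN1; congr (_ * _).
  exact: (esym (fmorph_eq_rat (toC \o ratr) _)).
move/(congr1 Num.norm); rewrite [RHS]normrM normr_sign mul1r => <-.
by rewrite ger0_norm // sqr_ge0.
Qed.

Lemma real_form_lincomb (w : 'I_n -> K) (c : 'rV[rat]_n) i :
  real_form (s i (lincomb w c)) = (map_mx ratr c *m formmx w) 0 i.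
Proof.
rewrite !mxE rmorph_lincomb /real_form !raddf_sum -big_split.
apply: eq_bigr => l _; rewrite !mxE.
have -> : ratr (c 0 l) = (ratr (c 0 l) : R)%:C%C :> C.
  exact: (esym (fmorph_eq_rat (toC \o ratr) _)).
by case: (s i (w l)) => a b /=; rewrite !mul0r subr0 addr0 mulrDr.
Qed.

Lemma formmx_mul (w : 'I_n -> K) (P : 'M[rat]_n) :
  formmx (fun k => lincomb w (row k P)) = map_mx ratr P *m formmx w.
Proof.
apply/row_matrixP => k; apply/rowP => i.
by rewrite row_mul -map_row -real_form_lincomb !mxE.
Qed.

(** det P is the norm of [a]: the conjugate matrix of [w] turns P into the diagonal matrix of the
    conjugates of [a]. *)
Lemma prod_norm_conjugates (w : 'I_n -> K) (a : K) (P : 'M[rat]_n) : spans w ->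
  (forall k, a * w k = lincomb w (row k P)) ->
  `|ratr (\det P) : C| = \prod_i `|s i a|.
Proof.
move=> spw aP; rewrite -normr_prod; congr (`|_|).
have dw : \det (conjmx s w) != 0 by apply/(spans_conjmx det_s).
have := conjmx_scale s w a.
rewrite (_ : (fun k => _) = fun k => lincomb w (row k P)); last exact/funext.
rewrite conjmx_mul => /(congr1 determinant); rewrite !det_mulmx mulrC.
move/(mulfI dw); rewrite det_map_mx det_diag /= => ->.
by apply: eq_bigr => i _; rewrite mxE.
Qed.

(** |z|^2 is the mean of (Re z + Im z)^2 and (Re z - Im z)^2. *)
Lemma norm_le_of_real_form (z : R[i]) (t : R) :
  `|real_form z| <= t -> `|real_form z^*%C| <= t -> `|z| ^+ 2 <= (t ^+ 2)%:C%C.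
Proof.
case: z => a b; rewrite -add_Re2_Im2 lecR /real_form /= => h1 h2.
have t0 : 0 <= t by apply: le_trans h1.
move: h1 h2; rewrite !ler_norml => /andP[h1 h2] /andP[h3 h4].
nra.
Qed.

End RealForms.

(** * Small elements of an ideal with principal square, and the theorem *)

Lemma class_order2_square (K : fieldExtType rat) (J : set K) :
  class_order2 (ideal_class J) ->
  exists2 alpha : K, alpha != 0 & ideal_mul J J = principal_ideal alpha.
Proof.
have self (I : set K) : ideal_class I I.
  by exists 1; rewrite ?oner_eq0 // /ideal_scale; under eq_fun do rewrite mul1r; rewrite image_id.
move=> [_ JJ]; have : class_mul (ideal_class J) (ideal_class J) (ideal_mul J J).
  by exists J, J; split.
by rewrite JJ => -[a a0 ->]; exists a.
Qed.

Lemma ideal_mul_scale (K : fieldExtType rat) (a : K) (J : set K) :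
  ideal_mul (ideal_scale a J) (ideal_scale a J) =
  ideal_scale (a ^+ 2) (ideal_mul J J).
Proof.
apply/seteqP; split=> z.
  move=> [t tJ ->]; elim: t tJ => [_|p t IH tJ].
    by exists 0; [exists [::]; rewrite ?big_nil|rewrite mulr0 big_nil].
  have [q qt|z' [t' t'J ->] E] := IH; first by apply: tJ; rewrite inE qt orbT.
  have [[x Jx xE] [y Jy yE]] := tJ p (mem_head _ _).
  exists (x * y + \sum_(q <- t') q.1 * q.2).
    exists ((x, y) :: t'); last by rewrite big_cons.
    by move=> q; rewrite inE => /predU1P[->|/t'J].
  by rewrite mulrDr E big_cons -xE -yE; congr (_ + _); ring.
move=> [_ [t tJ ->] <-]; exists [seq (a * p.1, a * p.2) | p <- t].
  move=> _ /mapP[p /tJ[Jp1 Jp2] ->].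
  by split; [exists p.1|exists p.2].
by rewrite big_map mulr_sumr; apply: eq_bigr => p _ /=; ring.
Qed.

Lemma ideal_scale_scale (K : fieldExtType rat) (a b : K) (J : set K) :
  ideal_scale a (ideal_scale b J) = ideal_scale (a * b) J.
Proof.
apply/seteqP; split=> z.
  by move=> [_ [x Jx <-] <-]; exists x => //; rewrite mulrA.
by move=> [x Jx <-]; exists (b * x); [exists x|rewrite mulrA].
Qed.

Lemma ex_small_element (R : realType) (K : fieldExtType rat) (J : set K) (alpha : K) :
  fractional_ideal J -> alpha != 0 -> ideal_mul J J = principal_ideal alpha ->
  exists x : K, [/\ J x, x != 0 & forall t : {rmorphism K -> R[i]},
    `|t x| ^+ 2 <= `|t alpha| *
       (`|ratr (field_disc K) : R| `^ ((\dim {:K})%:R^-1))%:C%C].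
Proof.
move=> J_ideal alpha0 JJ; set n := \dim {:K}.
have n_gt0 : (0 < n)%N by apply: adim_gt0.
have [s [s_inj s_complete det_s]] := ex_complete_embeddings R[i] K.
have [w [w_basis w_spans ->]] := ex_field_disc K.
have [j [Jj j_spans j_basis]] := ex_ideal_basis J_ideal.
have [M ME] := spans_coords j w_spans.
have [N NE] := spans_coords (fun k => alpha^-1 * tnth w k) w_spans.
have cov := ideal_square_covolume J_ideal alpha0 JJ w_basis w_spans Jj j_basis ME NE.
set D : R := `|ratr (basis_disc w)|.
(* Chosen so that c^n is the square root of D, the covolume bound, and c^2 is the D^(1/n) of the
   conclusion. *)
pose c : R := D `^ ((2 * n)%:R^-1).
pose v i : R := complex.Re `|s i alpha|.
have vE i : (v i)%:C%C = `|s i alpha| by rewrite /v RRe_real ?normr_real.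
have v_gt0 i : 0 < v i.
  by rewrite -ltcR vE normr_gt0 fmorph_eq0.
have D_gt0 : 0 < D.
  rewrite normr_gt0 fmorph_eq0 -(fmorph_eq0 (ratr : {rmorphism rat -> R[i]})) /=.
  by rewrite (basis_disc_conjmx det_s) expf_neq0 //; apply/(spans_conjmx det_s).
have c_gt0 : 0 < c by apply: powR_gt0.
have cn : (c ^+ n) ^+ 2 = D.
  rewrite -exprM mulnC -powR_mulrn ?(ltW c_gt0) // /c -powRrM mulVf ?powRr1 ?(ltW D_gt0) //.
  by rewrite pnatr_eq0 muln_eq0 /= -lt0n.
have c2 : c ^+ 2 = D `^ n%:R^-1.
  rewrite -powR_mulrn ?(ltW c_gt0) // /c -powRrM; congr (_ `^ _).
  by rewrite natrM invfM mulrAC mulVf ?mul1r // pnatr_eq0.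
pose A : 'M[R]_n := formmx s j *m diag_mx (\row_i (Num.sqrt (v i))^-1).
(* The scaling contributes the product of the 1/|s_i alpha|, which is |det N|; by [cov] the
   right-hand side is at most D. *)
have detA2 : (\det A) ^+ 2 = ratr (\det M) ^+ 2 * D * ratr `|\det N|.
  rewrite det_mulmx exprMn.
  rewrite (_ : j = fun k => lincomb (tnth w) (row k M)); last exact/funext.
  rewrite formmx_mul det_mulmx exprMn (det_formmx_sqr s_inj s_complete det_s) det_map_mx.
  congr (_ * _); rewrite det_diag -prodrXl; apply: (@complexI R).
  rewrite [LHS]rmorph_prod; transitivity (`|ratr (\det N) : R[i]|).
    rewrite (prod_norm_conjugates det_s w_spans NE); apply: eq_bigr => i _.
    by rewrite mxE exprVn sqr_sqrtr ?ltW // fmorphV /= vE fmorphV normfV.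
  rewrite -(fmorph_eq_rat (real_complex R \o ratr)) /= normc_def /= expr0n addr0.
  by rewrite sqrtr_sqr ratr_norm.
have detM_neq0 : \det M != 0.
  have /(spans_conjmx det_s) : spans (fun k => lincomb (tnth w) (row k M)).
    by rewrite -(_ : j = fun k => lincomb (tnth w) (row k M)) //; apply/funext.
  by rewrite conjmx_mul det_mulmx mulf_eq0 negb_or det_map_mx fmorph_eq0 => /andP[].
have [detA_neq0 detA_le] : \det A != 0 /\ `|\det A| <= c ^+ n.
  split; last first.
    rewrite -(@ler_pXn2r _ 2) ?nnegrE ?exprn_ge0 ?(ltW c_gt0) // cn.
    rewrite -normrX ger0_norm ?sqr_ge0 // detA2 mulrAC ger_pMl //.
    have := cov; rewrite normrM (ger0_norm (sqr_ge0 _)) -(ler_rat R).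
    by rewrite rmorphM rmorphXn rmorph1.
  rewrite /A det_mulmx mulf_neq0 //.
    rewrite (_ : j = fun k => lincomb (tnth w) (row k M)); last exact/funext.
    rewrite formmx_mul det_mulmx det_map_mx mulf_neq0 ?fmorph_eq0 //.
    apply: contraTneq D_gt0 => detw.
    by rewrite /D -(det_formmx_sqr s_inj s_complete det_s) detw expr0n ltxx.
  rewrite det_diag; apply/prodf_neq0 => i _.
  by rewrite mxE invr_eq0 gt_eqF // sqrtr_gt0.
have [m m0 m_le] := minkowski_linear_forms n_gt0 detA_neq0 c_gt0 detA_le.
exists (lincomb j (map_mx intr m)); split.
- rewrite lincomb_int; have [J0 JD JM _ _] := J_ideal.
  apply: (big_ind J) => // k _; rewrite -mulrzl; apply: JM => //.
  exact: ring_of_integers_int.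
- rewrite -(_ : lincomb j 0 = 0); last by rewrite /lincomb big1 // => k _; rewrite mxE scale0r.
  rewrite (inj_eq (lincomb_inj j_spans)).
  by apply: contraNneq m0 => /rowP mE; apply/eqP/rowP => k; have := mE k;
    rewrite !mxE => /eqP; rewrite intr_eq0 => /eqP.
set x := lincomb _ _ => t.
have form_le i : `|real_form (s i x)| <= c * Num.sqrt (v i).
  have := m_le i; rewrite mulmxA mul_mx_diag mxE [X in _ * X]mxE.
  have -> : map_mx intr m = map_mx ratr (map_mx intr m : 'rV[rat]_n) :> 'rV[R]_n.
    by apply/rowP => k; rewrite !mxE ratr_int.
  rewrite -real_form_lincomb -/x normrM normfV (ger0_norm (sqrtr_ge0 _)).
  by rewrite ler_pdivrMr ?sqrtr_gt0.
have [p pE] := ex_conj_perm s_inj s_complete.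
have [i ti] := s_complete t; rewrite !ti -c2 -vE mulrC -rmorphM.
have -> : c ^+ 2 * v i = (c * Num.sqrt (v i)) ^+ 2.
  by rewrite exprMn sqr_sqrtr // ltW.
(* The form at the conjugate embedding obeys the same bound, since |s_i alpha| is invariant under
   conjugation. *)
apply: norm_le_of_real_form; first exact: form_le.
have := form_le (p i); rewrite pE /v pE normcJ; exact.
Qed.

Theorem theorem1p5 (R : realType) (K : fieldExtType rat) (n : nat)
    (hn : \dim {:K} = n) (c : set (set K))
    (hc : class_group c) (hc2 : class_order2 c) :
  exists I : set K,
    [/\ c I,
        I `<=` @ring_of_integers K
      & exists beta : K,
          [/\ ring_of_integers beta,
              ideal_mul I I = principal_ideal beta
            & forall v : K -> R, infinite_places v ->
                v beta <= `|ratr (field_disc K) : R| `^ (n%:R^-1)]].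
Proof.
case: hc hc2 => J J_ideal <- /class_order2_square[alpha alpha0 JJ].
have [x [Jx x0 x_le]] := ex_small_element R J_ideal alpha0 JJ.
have Odiv := ideal_prod_div alpha0 JJ.
(* Integral because x J lies in J J = alpha O; its square is (x / alpha)^2 alpha O. *)
exists (ideal_scale (x / alpha) J); split.
- by exists (x / alpha) => //; rewrite mulf_neq0 ?invr_eq0.
- by move=> _ [y Jy <-]; rewrite mulrAC; apply: Odiv.
exists (x * x / alpha); split.
- exact: Odiv.
- rewrite ideal_mul_scale JJ /principal_ideal ideal_scale_scale; congr ideal_scale.
  by field.
move=> v [t tE]; rewrite -lecR tE -hn rmorphM fmorphV normrM normfV rmorphM normrM.
by rewrite ler_pdivrMr ?normr_gt0 ?fmorph_eq0 // mulrC -expr2 mulrC.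
Qed.
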